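(* Let $A, B \in M_+(n,\mathbb{C})$, $X \in M(n,\mathbb{C})$, and let $m \geq 1$ be an integer. Then $$\left\| \int_0^1 A^{\nu}XB^{1-\nu}\,d\nu \right\|_F \ge \frac{1}{m}\left\| \sum_{k=1}^m A^{\frac{2k-1}{2m}} X B^{\frac{2m-(2k-1)}{2m}} \right\|_F \ge \frac{1}{m}\left\| \sum_{k=1}^m A^{\frac{k}{m+1}} X B^{\frac{m+1-k}{m+1}} \right\|_F \ge \left\| A^{1/2}XB^{1/2} \right\|_F .$$
   Context: $M(n,\mathbb{C})$ is the set of all $n\times n$ complex matrices and $M_+(n,\mathbb{C})$ is the set of all $n\times n$ positive semidefinite complex matrices. $\|A\|_F = \left(\sum_{i,j=1}^n |a_{ij}|^2\right)^{1/2} = (\mathrm{Tr}[A^*A])^{1/2}$ is the Frobenius (Hilbert-Schmidt) norm. Powers of positive semidefinite matrices are defined by the functional calculus, and the integral is taken entrywise. *)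

(* Defs.v *)
From HB Require Import structures.
From mathcomp Require Import all_boot all_order all_algebra.
From mathcomp Require Import complex.
From mathcomp Require Import all_classical all_reals all_analysis.

Set Implicit Arguments.
Unset Strict Implicit.
Unset Printing Implicit Defensive.

Import Order.TTheory GRing.Theory Num.Theory.
Local Open Scope ring_scope.
Local Open Scope complex_scope.
Local Open Scope sesquilinear_scope.

Definition psdmx (R : realType) (n : nat) (A : 'M[R[i]]_n) : Prop :=
  A \is hermsymmx /\ forall v : 'cV[R[i]]_n, 0 <= (v ^t* *m A *m v) 0 0.

(* Functional calculus f(A) = P^-1 diag(f(lambda_i)) P, where
   A = P^-1 diag(lambda_i) P with P unitary.  It is meant for Hermitian A:
   the lambda_i are then real, so that taking their real part loses nothing. *)
Definition funmx (R : realType) (n : nat) (f : R -> R) (A : 'M[R[i]]_n) :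
    'M[R[i]]_n :=
  invmx (spectralmx A)
    *m diag_mx (map_mx (fun z : R[i] => (f (complex.Re z))%:C) (spectral_diag A))
    *m spectralmx A.

(* Since 0 `^ 0 = 1, powmx A 0 is the identity even for singular A. *)
Definition powmx (R : realType) (n : nat) (A : 'M[R[i]]_n) (r : R) :
    'M[R[i]]_n :=
  funmx (fun x => x `^ r) A.

Definition frobenius (R : realType) (n : nat) (A : 'M[R[i]]_n) : R :=
  Num.sqrt (\sum_i \sum_j (Normc.normc (A i j)) ^+ 2).

Definition integralmx01 (R : realType) (n : nat) (F : R -> 'M[R[i]]_n) :
    'M[R[i]]_n :=
  \matrix_(i, j)
    ((\int[lebesgue_measure]_(x in `[0, 1]) complex.Re (F x i j))
     +i* (\int[lebesgue_measure]_(x in `[0, 1]) complex.Im (F x i j))).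

(* Main.v *)
(* In eigenbases of A and B each of the four matrices becomes the entrywise
   product of the fixed matrix Y = U X V^-1 (U, V the unitaries diagonalising
   A, B) with a matrix of nonnegative reals, and the Frobenius norm is
   unitarily invariant.  So it suffices to compare, for all eigenvalues a, b,
   the corresponding averages of nu |-> a^nu b^(1-nu).  For nonzero a and b this
   function is C exp((nu - 1/2) d).  The nodes of each sum are symmetric about
   1/2, so pairing nu with 1 - nu turns the sums into sums of cosh, and the nodes
   k/(m+1) are closer to 1/2 than the midpoints (2k-1)/(2m).  The integral is
   compared with the midpoint sum on each interval [(k-1)/m, k/m], by
   x <= sinh x. *)

Require Import Defs.
From HB Require Import structures.
From mathcomp Require Import all_boot all_order all_algebra.
From mathcomp Require Import complex ring lra.
From mathcomp Require Import all_classical all_reals all_analysis.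
From mathcomp Require Import measurable_realfun.

Import Order.TTheory GRing.Theory Num.Theory.
Import numFieldNormedType.Exports.
Local Open Scope ring_scope.
Local Open Scope complex_scope.
Local Open Scope sesquilinear_scope.

(** * Two inequalities for exponentials *)

(** The difference of the two sides vanishes at 0, and its derivative is the square of [exp t - 1]
    divided by [exp t]. *)
Lemma ler_expR_sub_expRN {R : realType} (x : R) :
  0 <= x -> x *+ 2 <= expR x - expR (- x).
Proof.
move=> x0.
pose f (t : R) := expR t - expR (- t) - 2 * t.
have df (t : R) : is_derive t (1 : R) f (expR t + expR (- t) - 2).
  by rewrite /f; apply: is_derive_eq; rewrite /GRing.scale /=; ring.
suff : f 0 <= f x by rewrite /f oppr0 subrr mulr0 subr0 mulr_natl subr_ge0.
apply: (@ger0_derive1_ndecr _ f 0 x) => //.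
- move=> t _; rewrite derive1E (@derive_val _ _ _ _ _ _ _ (df t)).
  have := expR_gt0 t; rewrite expRN => /lt0r_neq0 e0.
  have -> : expR t + (expR t)^-1 - 2 = (expR t - 1) ^+ 2 / expR t by field.
  by rewrite divr_ge0 ?sqr_ge0 ?expR_ge0.
- apply: continuous_subspaceT => t.
  by apply: differentiable_continuous; apply/derivable1_diffP.
Qed.

(** Monotonicity of cosh in the absolute value, without derivatives: once [0 <= x], the difference
    factors as [(exp x - exp y) (1 - exp (- x - y))], and both factors are nonnegative because
    [- x <= y <= x]. *)
Lemma ler_expR_addN {R : realType} (x y : R) :
  `|y| <= `|x| -> expR y + expR (- y) <= expR x + expR (- x).
Proof.
wlog x0 : x / 0 <= x => [wl|].
  have [/wl//|/ltW x0] := leP 0 x.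
  by have := wl (- x); rewrite normrN opprK [expR (- x) + _]addrC; apply;
     rewrite oppr_ge0.
rewrite (ger0_norm x0) ler_norml => /andP[xy yx].
rewrite -subr_ge0.
have -> : expR x + expR (- x) - (expR y + expR (- y)) =
          (expR x - expR y) * (1 - expR (- x - y)).
  by rewrite mulrBr mulr1 mulrBl -!expRD addrA addrN add0r addrCA subrr addr0; ring.
apply: mulr_ge0; rewrite subr_ge0 ?ler_expR// -[leRHS]expR0 ler_expR; lra.
Qed.

(** * Weighted geometric means of two scalars: symmetric sums and integral *)

Definition heinz_weight {R : realType} (a b nu : R) : R := a `^ nu * b `^ (1 - nu).

Lemma heinz_weight_ge0 {R : realType} (a b nu : R) : 0 <= heinz_weight a b nu.
Proof. by rewrite mulr_ge0 ?powR_ge0. Qed.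

(* This includes negative a or b, where ln is 0 and a `^ nu is exp (nu * ln a) = 1. *)
Lemma heinz_weight_expR {R : realType} (a b nu : R) : a != 0 -> b != 0 ->
  heinz_weight a b nu = expR ((ln a + ln b) / 2 + (nu - 1 / 2) * (ln a - ln b)).
Proof.
move=> /negbTE a0 /negbTE b0; rewrite /heinz_weight /powR a0 b0 -expRD.
by congr expR; field.
Qed.

(** The endpoints are excluded because [0]^ 0 = 1[: for]a = 0[and]nu = 0[the weight is]b [^ 1]. *)
Lemma heinz_weight_eq0 {R : realType} (a b nu : R) : 0 < nu < 1 ->
  (a == 0) || (b == 0) -> heinz_weight a b nu = 0.
Proof.
move=> /andP[n0 n1] /orP[]/eqP ->; rewrite /heinz_weight powR0 ?mul0r ?mulr0//; lra.
Qed.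

(** The weight can jump at an endpoint when [a] or [b] is 0, so the argument uses boundedness and
    measurability instead of continuity. *)
Lemma integrable_heinz_weight {R : realType} (a b : R) :
  lebesgue_measure.-integrable `[0, 1] (EFin \o heinz_weight a b).
Proof.
(* The summand 1 covers [c = 0], where the power is 0 or 1; the other one covers
   [exp (nu * ln c)]. *)
have powR_bound (c nu : R) : 0 <= nu <= 1 -> c `^ nu <= 1 + expR `|ln c|.
  move=> nu01; rewrite /powR; case: ifP => _.
    by case: (nu == 0); rewrite ?lerDl ?expR_ge0 // addr_ge0 ?expR_ge0.
  rewrite -[leLHS]add0r lerD// ler_expR; case: (ger0P (ln c)) => ?; nra.
apply: measurable_bounded_integrable => //.
- by have /= := @lebesgue_measure_itv R `[0, 1]; rewrite lte01 oppr0 adde0 => ->;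
     rewrite ltry.
- apply: measurable_funM; first by apply: measurable_funTS; exact: measurable_powRr.
  apply: measurable_funTS; apply: measurableT_comp; first exact: measurable_powRr.
  exact: measurable_funB.
- exists ((1 + expR `|ln a|) * (1 + expR `|ln b|)); split; first exact: num_real.
  move=> M ltM nu /=; rewrite in_itv/= => nu01.
  rewrite ger0_norm ?heinz_weight_ge0// (le_trans _ (ltW ltM))//.
  by rewrite ler_pM ?powR_ge0 ?powR_bound//; lra.
Qed.

Lemma Rintegral_expR_affine {R : realType} (s d : R) : d != 0 ->
  \int[lebesgue_measure]_(x in `[0, 1]) expR (s + (x - 1 / 2) * d) =
  (expR (s + d / 2) - expR (s - d / 2)) / d.
Proof.
move=> d0.
pose F (x : R) := expR (s + (x - 1 / 2) * d) / d.
have dF (x : R) : is_derive x (1 : R) F (expR (s + (x - 1 / 2) * d)).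
  rewrite /F; apply: is_derive_eq; rewrite /GRing.scale /=; field => //.
have cF : continuous F.
  move=> x; apply: differentiable_continuous; apply/derivable1_diffP.
  exact: (@ex_derive _ _ _ _ _ _ _ (dF x)).
have cf : continuous (fun x : R => expR (s + (x - 1 / 2) * d)).
  move=> x; apply: differentiable_continuous; apply/derivable1_diffP.
  exact: ex_derive.
have LRF : derivable_oo_LRcontinuous F 0 1.
  split; [|exact/cvg_at_right_filter/cF|exact/cvg_at_left_filter/cF].
  by move=> x _; exact: (@ex_derive _ _ _ _ _ _ _ (dF x)).
have F'E : {in `]0, 1[, F^`()%classic =1 (fun x : R => expR (s + (x - 1 / 2) * d))}.
  by move=> x _; rewrite derive1E (@derive_val _ _ _ _ _ _ _ (dF x)).
rewrite /Rintegral (continuous_FTC2 ltr01 (continuous_subspaceT cf) LRF F'E).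
by rewrite /= /F -mulrBl; congr ((expR _ - expR _) / _); field.
Qed.

(** The reversal [k |-> m + 1 - k] reflects both families of nodes about 1/2, so adding each sum to
    its reversal leaves a termwise comparison of cosh. If [a] or [b] is 0, the left sum vanishes,
    its nodes being strictly between 0 and 1. *)
Lemma ler_sum_heinz_weight {R : realType} (a b : R) (m : nat) (x y : nat -> R) :
  (forall k, (1 <= k < m.+1)%N ->
     [/\ 0 < y k < 1, x (m.+1 - k)%N = 1 - x k, y (m.+1 - k)%N = 1 - y k
       & `|y k - 1 / 2| <= `|x k - 1 / 2|]) ->
  \sum_(1 <= k < m.+1) heinz_weight a b (y k) <=
  \sum_(1 <= k < m.+1) heinz_weight a b (x k).
Proof.
move=> xy; have [ab0|] := boolP ((a == 0) || (b == 0)).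
  rewrite big_nat big1 => [|k /xy[y01 _ _ _]]; last exact: heinz_weight_eq0.
  by apply: sumr_ge0 => k _; exact: heinz_weight_ge0.
rewrite negb_or => /andP[a0 b0].
have sumD (z : nat -> R) : (\sum_(1 <= k < m.+1) heinz_weight a b (z k)) *+ 2 =
    \sum_(1 <= k < m.+1)
      (heinz_weight a b (z k) + heinz_weight a b (z (m.+1 - k)%N)).
  by rewrite mulr2n {2}big_nat_rev /= -big_split.
rewrite -(@ler_pMn2r _ 2)// !sumD !big_nat; apply: ler_sum => k /xy[_ xk yk yx].
rewrite xk yk !heinz_weight_expR// !expRD -!mulrDr ler_pM2l ?expR_gt0//.
have opp (z : R) : (1 - z - 1 / 2) * (ln a - ln b) = - ((z - 1 / 2) * (ln a - ln b)).
  by field.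
by rewrite !opp; apply: ler_expR_addN; rewrite !normrM ler_wpM2r.
Qed.

Lemma midpoint_sum_heinz_weight_le {R : realType} (a b : R) (m : nat) :
  (0 < m)%N ->
  m%:R^-1 * \sum_(1 <= k < m.+1) heinz_weight a b ((2 * k%:R - 1) / (2 * m%:R)) <=
  \int[lebesgue_measure]_(nu in `[0, 1]) heinz_weight a b nu.
Proof.
move=> m0; have mR0 : 0 < m%:R :> R by rewrite ltr0n.
have [ab0|] := boolP ((a == 0) || (b == 0)).
  rewrite big_nat big1 => [|k /andP[k0 km]]; last first.
    have k1 : 1 <= k%:R :> R by rewrite ler1n.
    have kmR : k%:R <= m%:R :> R by rewrite ler_nat.
    apply: heinz_weight_eq0 => //.
    by rewrite divr_gt0 ?ltr_pdivrMr ?mulr_gt0//=; lra.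
  by rewrite mulr0; apply: Rintegral_ge0 => nu _; exact: heinz_weight_ge0.
rewrite negb_or => /andP[a0 b0].
have wE nu := @heinz_weight_expR R a b nu a0 b0.
under eq_bigr do rewrite wE.
under eq_Rintegral do rewrite wE.
set s := (ln a + ln b) / 2; set d := ln a - ln b.
(* For [d = 0] the weight is constant and the two sides agree; the antiderivative used afterwards
   divides by [d]. *)
have [->|d0] := eqVneq d 0.
  under eq_bigr do rewrite mulr0 addr0.
  under [leRHS]eq_Rintegral do rewrite mulr0 addr0.
  rewrite Rintegral_cst//= sumr_const_nat subn1/= -[expR _ *+ m]mulr_natl mulKf ?gt_eqF//.
  by have /= -> := @lebesgue_measure_itv R `[0, 1]; rewrite lte01 oppr0 adde0 mulr1.
rewrite Rintegral_expR_affine//.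
(* The antiderivative at the grid point [k / m]; the integral is the telescoping sum of its
   increments. *)
pose e (k : nat) : R := expR (s + (k%:R / m%:R - 1 / 2) * d) / d.
have -> : (expR (s + d / 2) - expR (s - d / 2)) / d = \sum_(1 <= k < m.+1) (e k - e k.-1).
  rewrite big_add1/= telescope_sumr// /e mulrBl divff ?gt_eqF// mul0r.
  by congr (expR _ / _ - expR _ / _); field.
rewrite mulr_sumr; apply: ler_sum_nat => -[//|k] _ /=.
(* On one subinterval, [c] is the exponent at the midpoint and [c - h], [c + h] are those at the two
   ends. *)
pose h : R := d / (2 * m%:R).
pose c : R := s + ((2 * k.+1%:R - 1) / (2 * m%:R) - 1 / 2) * d.
have -> : e k.+1 - e k = expR c * ((expR h - expR (- h)) / d).
  rewrite mulrA mulrBr -!expRD mulrBl /e /c /h -natr1.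
  by congr (expR _ / _ - expR _ / _); field; rewrite gt_eqF.
rewrite mulrC -/c ler_pM2l ?expR_gt0//.
(* This cancels [m^-1] and leaves [1 <= (exp h - exp (- h)) / (2 h)]. *)
have dE : d = m%:R * (h *+ 2) by rewrite /h; field; rewrite gt_eqF.
have h0 : h != 0 by apply: contraNneq d0 => h0; rewrite dE h0 mul0rn mulr0.
rewrite dE invfM mulrCA ler_pMr ?invr_gt0//.
(* The quotient is even in [h]. The first case is [h < 0], its hypothesis being the one called
   [h_gt0], and it uses the inequality at [- h]. *)
have [h_gt0|h_lt0|h_eq0] := ltgtP h 0; last by rewrite h_eq0 eqxx in h0.
  rewrite ler_ndivlMr ?pmulrn_llt0// mul1r.
  have := @ler_expR_sub_expRN R (- h); rewrite opprK oppr_ge0 => /(_ (ltW h_gt0)).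
  lra.
by rewrite ler_pdivlMr ?pmulrn_lgt0// mul1r ler_expR_sub_expRN// ltW.
Qed.

(** * Frobenius norm and entrywise scaling *)

Lemma sum_sqr_normc {R : realType} {n : nat} (M : 'M[R[i]]_n) :
  (\sum_i \sum_j Normc.normc (M i j) ^+ 2)%:C = \tr (M *m M^t*).
Proof.
rewrite rmorph_sum; apply: eq_bigr => i _; rewrite rmorph_sum mxE.
by apply: eq_bigr => j _; rewrite !mxE -normCK rmorphXn.
Qed.

(** The squared norm is the trace of a matrix times its adjoint: [V] cancels in the middle of that
    product, and [U] by cyclicity of the trace. *)
Lemma frobenius_unitary {R : realType} {n : nat} (U V M : 'M[R[i]]_n) :
  U \is unitarymx -> V \is unitarymx ->
  frobenius (invmx U *m M *m V) = frobenius M.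
Proof.
move=> hU hV; congr Num.sqrt; apply: (@complexI R).
rewrite !sum_sqr_normc invmx_unitary// trmx_mul map_mxM mulmxA mulmxtVK//.
rewrite trmx_mul map_mxM mulmxA mxtrace_mulC !mulmxA.
have -> : U^t*^t* = U.
  by rewrite map_trmx trmxK -map_mx_comp map_mx_id// => z; exact: conjCK.
by rewrite (unitarymxP hU) mul1mx.
Qed.

(** Hadamard product with real coefficients, so that comparing and integrating the weights takes
    place in [R]. *)
Definition hadamard_scale {R : realType} {n : nat} (c : 'I_n -> 'I_n -> R)
    (Y : 'M[R[i]]_n) : 'M[R[i]]_n := \matrix_(i, j) ((c i j)%:C * Y i j).

Lemma ler_frobenius_hadamard {R : realType} {n : nat} (c c' : 'I_n -> 'I_n -> R)
    (Y : 'M[R[i]]_n) :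
  (forall i j, 0 <= c i j <= c' i j) ->
  frobenius (hadamard_scale c Y) <= frobenius (hadamard_scale c' Y).
Proof.
move=> cc'; apply: ler_wsqrtr; apply: ler_sum => i _; apply: ler_sum => j _.
have /andP[c0 cle] := cc' i j.
have normcR (r : R) : 0 <= r -> Normc.normc r%:C = r.
  by move=> r0; rewrite /= expr0n addr0 sqrtr_sqr ger0_norm.
rewrite !mxE !Normc.normcM !normcR ?(le_trans c0)//.
by rewrite !exprMn ler_wpM2r ?sqr_ge0// lerXn2r// nnegrE (le_trans c0).
Qed.

Lemma frobeniusZ {R : realType} {n : nat} (r : R) (M : 'M[R[i]]_n) : 0 <= r ->
  frobenius (r%:C *: M) = r * frobenius M.
Proof.
move=> r0; rewrite /frobenius -{2}(ger0_norm r0) -sqrtr_sqr -sqrtrM ?sqr_ge0//.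
congr Num.sqrt; rewrite mulr_sumr; apply: eq_bigr => i _.
rewrite mulr_sumr; apply: eq_bigr => j _.
by rewrite mxE Normc.normcM exprMn /= expr0n addr0 sqr_sqrtr ?sqr_ge0.
Qed.

(** * Sums and integrals of sandwiched products *)

Lemma Rintegral_sumZ {R : realType} {I : finType} (w : I -> R) (f : I -> R -> R)
    (D : set (measurableTypeR R)) : measurable D ->
  (forall i, lebesgue_measure.-integrable D (EFin \o f i)) ->
  \int[lebesgue_measure]_(x in D) \sum_i w i * f i x =
  \sum_i w i * \int[lebesgue_measure]_(x in D) f i x.
Proof.
move=> mD fi.
have wfi i : lebesgue_measure.-integrable D (EFin \o (fun x => w i * f i x)).
  exact: (integrableZl mD (w i) (fi i)).
elim: (index_enum I) => [|i r IHr].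
  rewrite big_nil; under eq_Rintegral do rewrite big_nil.
  by rewrite Rintegral_cst// mul0r.
rewrite big_cons; under eq_Rintegral do rewrite big_cons.
rewrite RintegralD//; first by rewrite RintegralZl// IHr.
rewrite (_ : _ \o _ = fun x => (\sum_(j <- r) (w j * f j x)%:E)%E); last first.
  by apply/funext => x; rewrite /= sumEFin.
by apply: integrable_sum => // j _; exact: wfi.
Qed.

(** Separates the complex constants from the real weights, the only factors that will depend on the
    integration variable. *)
Lemma mulmx_hadamardE {R : realType} {n : nat} (P Q Y : 'M[R[i]]_n)
    (c : 'I_n -> 'I_n -> R) (p q : 'I_n) :
  (P *m hadamard_scale c Y *m Q) p q =
  \sum_(ij : 'I_n * 'I_n) (P p ij.1 * Y ij.1 ij.2 * Q ij.2 q) * (c ij.1 ij.2)%:C.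
Proof.
rewrite mxE -(pair_bigA _ (fun i j => P p i * Y i j * Q j q * (c i j)%:C)) /=.
rewrite exchange_big; apply: eq_bigr => j _.
by rewrite mxE mulr_suml; apply: eq_bigr => i _; rewrite mxE; ring.
Qed.

Lemma integralmx01_hadamard {R : realType} {n : nat} (P Q Y : 'M[R[i]]_n)
    (c : R -> 'I_n -> 'I_n -> R) :
  (forall i j, lebesgue_measure.-integrable `[0, 1]
     (EFin \o (fun nu : measurableTypeR R => c nu i j))) ->
  integralmx01 (fun nu => P *m hadamard_scale (c nu) Y *m Q) =
  P *m hadamard_scale
    (fun i j => \int[lebesgue_measure]_(nu in `[0, 1]) c nu i j) Y *m Q.
Proof.
move=> ci; apply/matrixP => p q; rewrite mxE.
pose w (ij : 'I_n * 'I_n) := P p ij.1 * Y ij.1 ij.2 * Q ij.2 q.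
(* [g] stands for the real or the imaginary part: both are additive and commute with real
   scalars. *)
have part (g : {additive R[i] -> R}) :
    (forall z (r : R), g (z * r%:C) = g z * r) ->
    \int[lebesgue_measure]_(x in `[0, 1]) g ((P *m hadamard_scale (c x) Y *m Q) p q) =
    g ((P *m hadamard_scale
      (fun i j => \int[lebesgue_measure]_(nu in `[0, 1]) c nu i j) Y *m Q) p q).
  move=> gZ; rewrite mulmx_hadamardE raddf_sum.
  under [RHS]eq_bigr do rewrite gZ.
  rewrite -(Rintegral_sumZ (fun ij => g (w ij)) (fun ij nu => c nu ij.1 ij.2))//.
  apply: eq_Rintegral => x _; rewrite mulmx_hadamardE raddf_sum.
  by apply: eq_bigr => ij _; rewrite gZ.
rewrite !part//.
- by case: ((_ *m _) p q).
- by case=> x y r; rewrite /= mulr0 add0r mulrC.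
- by case=> x y r; rewrite /= mulr0 subr0.
Qed.

(** Diagonal factors on the left and right scale rows and columns. The outer unitaries do not depend
    on [r] and [s], so sums and integrals over exponents act on the weights alone. *)
Lemma powmx_sandwich {R : realType} {n : nat} (A B X : 'M[R[i]]_n) (r s : R) :
  powmx A r *m X *m powmx B s =
  invmx (spectralmx A)
    *m hadamard_scale (fun i j => complex.Re (spectral_diag A 0 i) `^ r
                                  * complex.Re (spectral_diag B 0 j) `^ s)
         (spectralmx A *m X *m invmx (spectralmx B))
    *m spectralmx B.
Proof.
rewrite /powmx /funmx !mulmxA; congr (_ *m _); rewrite -!mulmxA; congr (_ *m _).
rewrite !mulmxA -2!(mulmxA (diag_mx _)).
apply/matrixP => i j; rewrite mul_mx_diag mxE mul_diag_mx !mxE.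
by rewrite rmorphM/=; ring.
Qed.

Lemma hadamard_scale_sum {R : realType} {n : nat} (I : Type) (r : seq I)
    (P : pred I) (c : I -> 'I_n -> 'I_n -> R) (Y : 'M[R[i]]_n) :
  \sum_(k <- r | P k) hadamard_scale (c k) Y =
  hadamard_scale (fun i j => \sum_(k <- r | P k) c k i j) Y.
Proof.
apply/matrixP => i j; rewrite summxE mxE rmorph_sum mulr_suml.
by apply: eq_bigr => k _; rewrite mxE.
Qed.

(** Contracting by [m / (m + 1)] towards 1/2 sends each midpoint to the corresponding node
    [k / (m + 1)]. *)
Lemma uniform_vs_midpoint_nodes {R : realFieldType} (m k : R) :
  0 < m -> 1 <= k <= m ->
  [/\ 0 < k / (m + 1) < 1,
      (2 * (m + 1 - k) - 1) / (2 * m) = 1 - (2 * k - 1) / (2 * m),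
      (m + 1 - k) / (m + 1) = 1 - k / (m + 1)
    & `|k / (m + 1) - 1 / 2| <= `|(2 * k - 1) / (2 * m) - 1 / 2|].
Proof.
move=> m0 /andP[k1 km].
have m1_gt0 : 0 < m + 1 by rewrite addr_gt0.
have m1 : m + 1 != 0 by rewrite gt_eqF.
have mN0 : m != 0 by rewrite gt_eqF.
split.
- by apply/andP; split; [rewrite divr_gt0//; lra|rewrite ltr_pdivrMr//; lra].
- by field.
- by field.
- have -> : k / (m + 1) - 1 / 2 =
      ((2 * k - 1) / (2 * m) - 1 / 2) * (m / (m + 1)).
    by field; rewrite m1.
  rewrite normrM ler_piMr// ger0_norm; first by rewrite ler_pdivrMr//; lra.
  by rewrite divr_ge0// ltW.
Qed.

Theorem theorem2p2 (R : realType) (n : nat) (A B X : 'M[R[i]]_n) (m : nat)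
    (hA : psdmx A) (hB : psdmx B) (hm : (1 <= m)%N) :
  [/\ frobenius (integralmx01 (fun nu => powmx A nu *m X *m powmx B (1 - nu)))
      >= m%:R^-1 * frobenius (\sum_(1 <= k < m.+1)
           powmx A ((2 * k%:R - 1) / (2 * m%:R)) *m X
             *m powmx B ((2 * m%:R - (2 * k%:R - 1)) / (2 * m%:R))),
      m%:R^-1 * frobenius (\sum_(1 <= k < m.+1)
           powmx A ((2 * k%:R - 1) / (2 * m%:R)) *m X
             *m powmx B ((2 * m%:R - (2 * k%:R - 1)) / (2 * m%:R)))
      >= m%:R^-1 * frobenius (\sum_(1 <= k < m.+1)
           powmx A (k%:R / (m%:R + 1)) *m X
             *m powmx B ((m%:R + 1 - k%:R) / (m%:R + 1)))
    & m%:R^-1 * frobenius (\sum_(1 <= k < m.+1)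
           powmx A (k%:R / (m%:R + 1)) *m X
             *m powmx B ((m%:R + 1 - k%:R) / (m%:R + 1)))
      >= frobenius (powmx A (1 / 2) *m X *m powmx B (1 / 2)) ].
Proof.
have half01 : 0 < (1 / 2 : R) < 1 by lra.
have half_sym : 1 / 2 = 1 - 1 / 2 :> R by field.
have m0 : 0 < m%:R :> R by rewrite ltr0n.
pose w (nu : R) (i j : 'I_n) := heinz_weight
  (complex.Re (spectral_diag A 0 i)) (complex.Re (spectral_diag B 0 j)) nu.
pose Y := spectralmx A *m X *m invmx (spectralmx B).
have w_ge0 nu i j : 0 <= w nu i j by exact: heinz_weight_ge0.
have sandwich (r s : R) : s = 1 - r ->
    powmx A r *m X *m powmx B s =
    invmx (spectralmx A) *m hadamard_scale (w r) Y *m spectralmx B.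
  by move=> ->; exact: powmx_sandwich.
have normE (c : 'I_n -> 'I_n -> R) :
    frobenius (invmx (spectralmx A) *m hadamard_scale c Y *m spectralmx B) =
    frobenius (hadamard_scale c Y).
  by rewrite frobenius_unitary ?spectral_unitarymx.
(* Both discrete means are instances of this; the factor [m^-1] is absorbed into the weights. *)
have meanE (x y : nat -> R) : (forall k, y k = 1 - x k) ->
    m%:R^-1 * frobenius (\sum_(1 <= k < m.+1) powmx A (x k) *m X *m powmx B (y k)) =
    frobenius (hadamard_scale
      (fun i j => m%:R^-1 * \sum_(1 <= k < m.+1) w (x k) i j) Y).
  move=> yx; under eq_bigr do rewrite sandwich//.
  rewrite -mulmx_suml -mulmx_sumr hadamard_scale_sum normE -frobeniusZ ?invr_ge0 ?ltW//.
  by congr frobenius; apply/matrixP => i j; rewrite !mxE mulrA -rmorphM.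
have m1_gt0 : 0 < m%:R + 1 :> R by rewrite addr_gt0.
have m1 : m%:R + 1 != 0 :> R by rewrite gt_eqF.
have m2 : m%:R != 0 :> R by rewrite gt_eqF.
have sum_ge0 (x : nat -> R) i j : 0 <= \sum_(1 <= k < m.+1) w (x k) i j.
  by apply: sumr_ge0.
have midE := meanE (fun k => (2 * k%:R - 1) / (2 * m%:R))
  (fun k => (2 * m%:R - (2 * k%:R - 1)) / (2 * m%:R)).
have gridE := meanE (fun k => k%:R / (m%:R + 1))
  (fun k => (m%:R + 1 - k%:R) / (m%:R + 1)).
split.
- rewrite [leLHS]midE; last by move=> k; field.
  have -> : (fun nu => powmx A nu *m X *m powmx B (1 - nu)) =
      (fun nu => invmx (spectralmx A) *m hadamard_scale (w nu) Y *m spectralmx B).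
    by apply/funext => nu; exact: sandwich.
  rewrite integralmx01_hadamard; last by move=> i j; exact: integrable_heinz_weight.
  rewrite normE; apply: ler_frobenius_hadamard => i j.
  by rewrite mulr_ge0 ?invr_ge0 ?(ltW m0)//= midpoint_sum_heinz_weight_le.
- rewrite [leRHS]midE; last by move=> k; field.
  rewrite [leLHS]gridE; last by move=> k; field.
  apply: ler_frobenius_hadamard => i j.
  rewrite mulr_ge0 ?invr_ge0 ?(ltW m0)//= ler_wpM2l ?invr_ge0 ?(ltW m0)//.
  apply: ler_sum_heinz_weight => k /andP[k0 km].
  (* The natural subtraction does not truncate, since [k <= m]. *)
  have -> : (m.+1 - k)%:R = m%:R + 1 - k%:R :> R by rewrite natrB ?(ltnW km)// -natr1.
  by apply: uniform_vs_midpoint_nodes; rewrite ?ler1n ?k0 ?ler_nat.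
- rewrite [leRHS]gridE; last by move=> k; field.
  rewrite sandwich; last by field.
  rewrite normE; apply: ler_frobenius_hadamard => i j; rewrite w_ge0/=.
  (* After clearing [m^-1], the single weight at 1/2 becomes a sum over [m] nodes all equal to 1/2,
     at distance 0 from the centre. *)
  rewrite [leRHS]mulrC ler_pdivlMr// mulr_natr.
  have -> : w (1 / 2) i j *+ m = \sum_(1 <= k < m.+1) w (1 / 2) i j.
    by rewrite sumr_const_nat subn1.
  apply: (@ler_sum_heinz_weight R _ _ m _ (fun=> 1 / 2)) => k /andP[k0 km].
  have -> : (m.+1 - k)%:R = m%:R + 1 - k%:R :> R by rewrite natrB ?(ltnW km)// -natr1.
  have k1m : 1 <= (k%:R : R) <= m%:R by rewrite ler1n k0 ler_nat.
  have [_ _ symk _] := uniform_vs_midpoint_nodes _ _ m0 k1m.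
  by split=> //; rewrite subrr normr0.
Qed.
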